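(* Let $\alpha,\mu,\sigma>0$ satisfy $4\alpha\mu\ge\sigma^2$, let $\theta\ge 1$ and $\Delta>0$, and let $(X_n)_{n\ge0}$ be the $\theta$-Milstein approximation of the CIR equation with step size $\Delta$ started at $X_0\ge 0$. Then the scheme preserves the non-negativity of the exact solution: $X_n\ge 0$ for all $n\ge 0$. In particular, under the Feller condition $2\alpha\mu\ge\sigma^2$ it preserves positivity: if $X_0>0$, then $X_n>0$ for all $n\ge0$.
   Context: The CIR equation is the SDE $dX(t)=\alpha(\mu-X(t))\,dt+\sigma\sqrt{X(t)}\,dW(t)$, where $\alpha,\mu,\sigma$ are positive constants and $W$ is a standard Wiener process; for $X(0)\ge 0$ it has a unique non-negative strong solution, which remains positive if $X(0)>0$ and the Feller condition $2\alpha\mu\ge\sigma^2$ holds. For a general SDE $dX=f(X)\,dt+g(X)\,dW$, the $\theta$-Milstein scheme with step size $\Delta>0$ is $X_{n+1}=X_n+\{(1-\theta)f(X_n)+\theta f(X_{n+1})\}\Delta+g(X_n)\Delta W_n+\frac12 g(X_n)g'(X_n)(\Delta W_n^2-\Delta)$, with $t_n=n\Delta$ and $\Delta W_n=W(t_{n+1})-W(t_n)$. For the CIR equation it reads, given $X_n\ge0$, $$X_{n+1}=\frac{1}{1+\alpha\theta\Delta}\left\{(1-\alpha\Delta+\alpha\theta\Delta)X_n+\left(\alpha\mu-\frac{\sigma^2}{4}\right)\Delta+\sigma\sqrt{X_n}\,\Delta W_n+\frac{\sigma^2}{4}\Delta W_n^2\right\}.$$ *)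

(* Defs.v *)
From HB Require Import structures.
From mathcomp Require Import all_boot all_order all_algebra.
From mathcomp Require Import all_classical all_reals all_analysis.
From mathcomp Require Import ring lra.
Set Implicit Arguments.
Unset Strict Implicit.
Unset Printing Implicit Defensive.
Import Order.TTheory GRing.Theory Num.Theory.
Import numFieldNormedType.Exports.
Local Open Scope classical_set_scope.
Local Open Scope ring_scope.

(* Time is a real number, and only the values W t with 0 <= t are constrained.
   The second parameter of normal_prob is the standard deviation. *)
Record is_wiener (R : realType) (d : measure_display) (T : measurableType d)
    (P : probability T R) (W : R -> {RV P >-> R}) : Prop := IsWiener {
  wiener_start : {ae P, forall w, W 0 w = 0} ;
  wiener_indep : forall (n : nat) (t : nat -> R) (A : nat -> set R),
    0 <= t 0%N -> (forall i, t i <= t i.+1) -> (forall i, measurable (A i)) ->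
    P [set w | forall i, (i < n)%N -> A i (W (t i.+1) w - W (t i) w)] =
    (\prod_(i < n) P [set w | A i (W (t i.+1) w - W (t i) w)%R])%E ;
  wiener_gauss : forall (s t : R) (A : set R),
    0 <= s -> s < t -> measurable A ->
    P [set w | A (W t w - W s w)] = normal_prob 0 (Num.sqrt (t - s)) A ;
  wiener_continuous :
    {ae P, forall w, {within `[0, +oo[, continuous (fun t : R => W t w)}} }.

(* One step of the theta-Milstein scheme for dX = f(X) dt + g(X) dW, from x to y
   with Wiener increment dw; it is implicit in y. *)
Definition theta_milstein_step (R : realType) (f g : R -> R)
    (theta Delta x dw y : R) : Prop :=
  y = x + ((1 - theta) * f x + theta * f y) * Delta + g x * dw
      + 1 / 2 * g x * derive1 g x * (dw ^+ 2 - Delta).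

Definition cir_drift (R : realType) (alpha mu x : R) : R := alpha * (mu - x).

Definition cir_diffusion (R : realType) (sigma x : R) : R :=
  sigma * Num.sqrt x.

Definition cir_theta_milstein_next (R : realType)
    (alpha mu sigma theta Delta x dw : R) : R :=
  1 / (1 + alpha * theta * Delta) *
  ((1 - alpha * Delta + alpha * theta * Delta) * x
   + (alpha * mu - sigma ^+ 2 / 4) * Delta
   + sigma * Num.sqrt x * dw + sigma ^+ 2 / 4 * dw ^+ 2).

(* For x > 0 the explicit formula is the solution of the implicit step. At
   x = 0 the derivative of the square root does not exist; there the explicit
   formula uses the continuous extension sigma^2 / 2 of g * g'. *)
Lemma cir_theta_milstein_stepP (R : realType)
    (alpha mu sigma theta Delta x dw y : R) :
  1 + alpha * theta * Delta != 0 -> 0 < x ->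
  theta_milstein_step (cir_drift alpha mu) (cir_diffusion sigma)
    theta Delta x dw y <->
  y = cir_theta_milstein_next alpha mu sigma theta Delta x dw.
Proof.
move=> D0 x0; rewrite /theta_milstein_step /cir_theta_milstein_next.
have -> : derive1 (cir_diffusion sigma) x = sigma * (2 * Num.sqrt x)^-1.
  rewrite derive1E; apply: derive_val.
  have : is_derive x 1 (@Num.sqrt R) (2 * Num.sqrt x)^-1 by exact: is_derive1_sqrt.
  move=> ds; exact: (is_deriveZ sigma ds).
rewrite /cir_drift /cir_diffusion.
have sx0 : Num.sqrt x != 0 by rewrite gt_eqF // sqrtr_gt0.
move: (Num.sqrt x) sx0 => s sx0.
have E : 1 / 2 * (sigma * s) * (sigma * (2 * s)^-1) = sigma ^+ 2 / 4 by field.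
rewrite E.
split=> h.
  have h' : (1 + alpha * theta * Delta) * y =
    (1 - alpha * Delta + alpha * theta * Delta) * x
    + (alpha * mu - sigma ^+ 2 / 4) * Delta + sigma * s * dw
    + sigma ^+ 2 / 4 * dw ^+ 2.
    by rewrite mulrDl mul1r {1}h; ring.
  by rewrite -h' mulrA div1r mulVf // mul1r.
by rewrite h; field.
Qed.

(* The recursion is only required where X n is non-negative, which is where its
   right-hand side is meaningful: Num.sqrt is 0 on negative arguments. *)
Definition is_cir_theta_milstein (R : realType) (d : measure_display)
    (T : measurableType d) (P : probability T R) (W : R -> {RV P >-> R})
    (alpha mu sigma theta Delta : R) (X : nat -> {RV P >-> R}) : Prop :=
  forall (n : nat) (w : T), 0 <= X n w ->
    X n.+1 w = cir_theta_milstein_next alpha mu sigma theta Delta (X n w)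
                 (W (n.+1%:R * Delta) w - W (n%:R * Delta) w).

(* Main.v *)
Require Import Defs.
From mathcomp Require Import all_boot all_order all_algebra.
From mathcomp Require Import all_classical all_reals all_analysis.
From mathcomp Require Import ring lra.
Import Order.TTheory GRing.Theory Num.Theory.
Import numFieldNormedType.Exports.
Local Open Scope ring_scope.

(** The Milstein correction [sigma ^+ 2 / 4 * dw ^+ 2] is exactly what completes
    the square of the noise term: for [0 <= x],
    [x + sigma * sqrt x * dw + sigma ^+ 2 / 4 * dw ^+ 2] equals
    [(sqrt x + sigma / 2 * dw) ^+ 2]. Since [1 <= theta], the drift leaves at
    least one full copy of [x] in the numerator of the step, so the numerator is
    the sum of that square, a non-negative multiple of [x] and the constant
    [(alpha * mu - sigma ^+ 2 / 4) * Delta] (see [cir_theta_milstein_nextE]).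
    Every path therefore stays non-negative, whatever the increments of the
    driving process are, as soon as that constant is non-negative. The Feller
    condition makes it positive, and with it every iterate. *)

Lemma cir_theta_milstein_nextE (R : realType)
    (alpha mu sigma theta Delta x dw : R) : 0 <= x ->
  cir_theta_milstein_next alpha mu sigma theta Delta x dw =
  (alpha * (theta - 1) * Delta * x + (alpha * mu - sigma ^+ 2 / 4) * Delta
   + (Num.sqrt x + sigma / 2 * dw) ^+ 2) / (1 + alpha * theta * Delta).
Proof.
move=> x0; rewrite /cir_theta_milstein_next div1r mulrC; congr (_ / _).
(* Only the occurrences of [x] outside the square roots become squares. *)
by rewrite -{1 3}(sqr_sqrtr x0); field.
Qed.

Lemma cir_theta_milstein_denom_gt0 (R : realType) (alpha theta Delta : R) :
  0 < alpha -> 1 <= theta -> 0 < Delta -> 0 < 1 + alpha * theta * Delta.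
Proof.
by move=> a0 t1 D0; rewrite ltr_pwDl // !mulr_ge0 ?ltW // (lt_le_trans ltr01).
Qed.

Lemma cir_theta_milstein_next_ge0 (R : realType)
    (alpha mu sigma theta Delta x dw : R) :
  0 < alpha -> sigma ^+ 2 <= 4 * alpha * mu -> 1 <= theta -> 0 < Delta ->
  0 <= x -> 0 <= cir_theta_milstein_next alpha mu sigma theta Delta x dw.
Proof.
move=> a0 sam t1 D0 x0; rewrite cir_theta_milstein_nextE //.
rewrite divr_ge0 //; last exact/ltW/cir_theta_milstein_denom_gt0.
rewrite !addr_ge0 ?sqr_ge0 // !mulr_ge0 ?subr_ge0 ?(ltW a0) ?(ltW D0) //.
lra.
Qed.

(** The strict inequality on the parameters keeps the step away from zero even
    when the increment makes the square vanish; positivity of [x] itself would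
    not do so, since its coefficient vanishes at [theta = 1]. *)
Lemma cir_theta_milstein_next_gt0 (R : realType)
    (alpha mu sigma theta Delta x dw : R) :
  0 < alpha -> sigma ^+ 2 < 4 * alpha * mu -> 1 <= theta -> 0 < Delta ->
  0 <= x -> 0 < cir_theta_milstein_next alpha mu sigma theta Delta x dw.
Proof.
move=> a0 sam t1 D0 x0; rewrite cir_theta_milstein_nextE //.
rewrite divr_gt0 ?cir_theta_milstein_denom_gt0 //.
rewrite ltr_wpDr ?sqr_ge0 // ltr_wpDl //.
  by rewrite !mulr_ge0 ?subr_ge0 ?(ltW a0) ?(ltW D0).
by rewrite mulr_gt0 //; lra.
Qed.

Theorem proposition2p1 (R : realType) (d : measure_display)
    (T : measurableType d) (P : probability T R) (W : R -> {RV P >-> R})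
    (alpha mu sigma theta Delta : R) (X : nat -> {RV P >-> R}) :
  0 < alpha -> 0 < mu -> 0 < sigma ->
  sigma ^+ 2 <= 4 * alpha * mu ->
  1 <= theta -> 0 < Delta ->
  is_wiener W ->
  is_cir_theta_milstein W alpha mu sigma theta Delta X ->
  (forall w : T, 0 <= X 0%N w -> forall n : nat, 0 <= X n w) /\
  (sigma ^+ 2 <= 2 * alpha * mu ->
   forall w : T, 0 < X 0%N w -> forall n : nat, 0 < X n w).
Proof.
move=> a0 mu0 s0 sam t1 D0 _ HX; split=> [w X0 | feller w X0].
  by elim=> [//|n IHn]; rewrite HX //; exact: cir_theta_milstein_next_ge0.
have sam' : sigma ^+ 2 < 4 * alpha * mu.
  by have := mulr_gt0 a0 mu0; lra.
elim=> [//|n /ltW IHn]; rewrite HX //.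
exact: cir_theta_milstein_next_gt0.
Qed.
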